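(* Let $a_1,a_2\in\{-1,+1\}$, $b_1,b_2\in\mathbb R$, and let $\varepsilon>0$ be small. Consider the regularization of the normal form two-fold singularity, i.e. the two-timescale system in the variables $(u,x_2,x_3)$ with fast variable $u$, $|u|<1$, $$(\varepsilon\dot u,\dot x_2,\dot x_3)=\frac{1+\phi_1(u)}2(-x_2,a_1,b_1)+\frac{1-\phi_1(u)}2(x_3,b_2,a_2).$$ Let $f_1(x_2,x_3;\phi_1(u))=-\frac{1+\phi_1(u)}2x_2+\frac{1-\phi_1(u)}2x_3$ denote its first component, let $$\mathcal M^S=\{(u,x_2,x_3)\in\mathbb R^3:\ f_1(x_2,x_3;\phi_1(u))=0,\ |u|<1\}$$ be its sliding manifold, and let $$\mathcal L=\Big\{(u,x_2,x_3)\in\mathcal M^S:\ \frac{\partial}{\partial u}f_1(x_2,x_3;\phi_1(u))=0\Big\}$$ be the non-hyperbolic set of $\mathcal M^S$. Then $\mathcal L$ lies everywhere tangent to the coordinate axis of the fast variable $u$; that is, $\mathcal L$ is a curve whose tangent direction at every point is $(1,0,0)$ in $(u,x_2,x_3)$-space.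
   Context: The normal form of the two-fold singularity is the piecewise smooth system $(\dot x_1,\dot x_2,\dot x_3)=(-x_2,a_1,b_1)$ for $x_1>0$ and $(\dot x_1,\dot x_2,\dot x_3)=(x_3,b_2,a_2)$ for $x_1<0$, with $a_i=\pm1$, $b_i\in\mathbb R$. It is written as a convex combination $\frac{1+\lambda}2(-x_2,a_1,b_1)+\frac{1-\lambda}2(x_3,b_2,a_2)$, with $\lambda=\mathrm{sign}(x_1)$ for $x_1\ne0$ and $\lambda\in[-1,1]$ for $x_1=0$. The regularization replaces $\lambda$ by a smooth sigmoid function $\phi_\varepsilon(x_1)=\phi_1(x_1/\varepsilon)$ and sets $u=x_1/\varepsilon$. Here $\phi_1$ is smooth with $\phi_1(\pm1)=\pm1$ and $\phi_1'(u)>0$ for $|u|<1$ (so $\phi_1$ maps $(-1,1)$ bijectively onto $(-1,1)$). Only $|u|<1$ is considered. *)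

(* Defs.v *)
From HB Require Import structures.
From mathcomp Require Import all_boot all_order all_algebra.
From mathcomp Require Import all_classical all_reals all_analysis.

Set Implicit Arguments.
Unset Strict Implicit.
Unset Printing Implicit Defensive.

Import Order.TTheory GRing.Theory Num.Theory.
Import numFieldNormedType.Exports.

Local Open Scope ring_scope.
Local Open Scope classical_set_scope.

Section Curves.
Context {R : realType} {V : normedModType R}.
Implicit Types (C : set V) (g : R -> V).

(* C^oo on the set I, which is meant to be open. *)
Definition smooth_on (I : set R) g :=
  forall (n : nat) (t : R), I t -> derivable (g^`(n)) t 1.

(* g is a regular parametrization of the set S by I, and a homeomorphism
   onto S: the condition on h makes g injective on I with continuous inverse. *)
Definition regular_parametrization (I : set R) g (S : set V) :=
  [/\ smooth_on I g,
      (forall t, I t -> g^`() t != 0),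
      g @` I = S &
      exists h : V -> R,
        {within S, continuous h} /\ (forall t, I t -> h (g t) = t)].

(* A connected one-dimensional embedded smooth submanifold of V. *)
Definition smooth_curve C :=
  [/\ C !=set0,
      connected C &
      forall p, C p -> exists (U : set V) (I : set R) (g : R -> V),
        [/\ open U, U p, open I, is_interval I &
            regular_parametrization I g (C `&` U)]].

(* The velocities at p of the smooth paths that stay in C. *)
Definition tangent_space C (p : V) : set V :=
  [set v | exists (d : R) (g : R -> V),
     [/\ 0 < d, smooth_on `]- d, d[ g,
         (forall t, `]- d, d[ t -> C (g t)),
         g 0 = p & g^`() 0 = v]].

End Curves.

Section TwoFold.
Context {R : realType}.

Definition sigmoid (phi : R -> R) :=
  [/\ smooth_on setT phi, phi (-1) = -1, phi 1 = 1 &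
      forall u, `|u| < 1 -> 0 < phi^`() u].

Definition vec3 (x y z : R) : 'rV[R]_3 := \row_(j < 3) [:: x; y; z]`_j.

Definition e_u : 'rV[R]_3 := vec3 1 0 0.

Variables (a1 a2 b1 b2 : R).

(* With lam = phi u, this is (eps * u', x2', x3') along the regularized
   system. *)
Definition two_fold (x2 x3 lam : R) : 'rV[R]_3 :=
  ((1 + lam) / 2) *: vec3 (- x2) a1 b1 + ((1 - lam) / 2) *: vec3 x3 b2 a2.

Definition f1 (x2 x3 lam : R) : R := two_fold x2 x3 lam 0 0.

Lemma f1E x2 x3 lam :
  f1 x2 x3 lam = - ((1 + lam) / 2) * x2 + (1 - lam) / 2 * x3.
Proof. by rewrite /f1 /two_fold !mxE /= mulrN mulNr. Qed.

Variable phi : R -> R.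

(* Points are p = (u, x2, x3). The scalar eps multiplies u' in the system but
   does not enter f1, so none of the following sets depends on it. *)
Definition sliding_manifold : set 'rV[R]_3 :=
  [set p | f1 (p 0 1) (p 0 2) (phi (p 0 0)) = 0 /\ `|p 0 0| < 1].

Definition nonhyperbolic_set : set 'rV[R]_3 :=
  [set p | sliding_manifold p /\
           (fun u : R => f1 (p 0 1) (p 0 2) (phi u))^`() (p 0 0) = 0].

End TwoFold.

(* Main.v *)
Require Import Defs.
From HB Require Import structures.
From mathcomp Require Import ring lra.
From mathcomp Require Import all_boot all_order all_algebra.
From mathcomp Require Import all_classical all_reals all_analysis.

Set Implicit Arguments.
Unset Strict Implicit.
Unset Printing Implicit Defensive.

Import Order.TTheory GRing.Theory Num.Theory.
Import numFieldNormedType.Exports.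

Local Open Scope ring_scope.
Local Open Scope classical_set_scope.

Section AffineMaps.
Context {R : realType} {V : normedModType R}.

(** The function [f1] is affine in [phi u]: it equals [(x3 - x2) / 2 - phi u * (x2 + x3) / 2]. Its
    [u]-derivative is therefore [- (x2 + x3) / 2] times [phi'(u)], and [phi' > 0] turns degeneracy
    into [x2 + x3 = 0]. Then [f1 = 0] leaves [x2 = x3], so both vanish, and the non-hyperbolic set
    is the open segment [|u| < 1] of the [u]-axis ([nonhyperbolic_setE]). What remains concerns a
    straight segment only: [smooth_curve_e_u] and [tangent_space_e_u]. *)

Lemma is_derive_line (x v : V) (t : R) :
  is_derive t 1 (fun s : R => x + s *: v) v.
Proof.
have sc : is_derive t 1 (fun s : R => s *: v) v.
  have df : is_diff t ( *:%R^~ v) ( *:%R^~ v) by exact: is_diff_scalel.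
  apply: DeriveDef; first by apply/derivable1_diffP.
  by rewrite deriveE// diff_val scale1r.
by rewrite -[X in is_derive _ _ _ X]add0r; apply: is_deriveD.
Qed.

Lemma derive1_line (x v : V) : (fun s : R => x + s *: v)^`() = cst v.
Proof.
apply/funext => t; rewrite derive1E.
exact: (@derive_val _ _ _ _ _ _ _ (is_derive_line x v t)).
Qed.

Lemma smooth_on_line (I : set R) (x v : V) :
  smooth_on I (fun s : R => x + s *: v).
Proof.
(* Only the constancy of the higher derivatives matters, so their value is left existential. *)
have cstn n : exists w : V, (cst v : R -> V)^`(n) = cst w.
  elim: n => [|n [w IHn]]; first by exists v.
  by exists 0; apply/funext => t; rewrite derive1nS IHn derive1_cst.
case=> [|n] t _; first by have [] := is_derive_line x v t.
by have [w Hw] := cstn n; rewrite derive1Sn derive1_line Hw; exact: derivable_cst.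
Qed.

Lemma continuous_line (x v : V) : continuous (fun s : R => x + s *: v).
Proof.
move=> t; apply: cvgD; first exact: cvg_cst.
exact: scalel_continuous.
Qed.

End AffineMaps.

Section AxisOfFastVariable.
Context {R : realType}.

Lemma vec3_eta (p : 'rV[R]_3) : p = vec3 (p 0 0) (p 0 1) (p 0 2).
Proof.
apply/rowP => j; rewrite mxE.
by case: j => -[|[|[|//]]] lj /=; congr (p 0 _); apply: val_inj.
Qed.

Lemma scale_e_u (k : R) : k *: e_u = vec3 k 0 0.
Proof.
apply/rowP => j; rewrite !mxE.
by case: j => -[|[|[|//]]] lj /=; rewrite ?mulr1 ?mulr0.
Qed.

(* On [L] both [(1 + phi) x2 = (1 - phi) x3] and, since [phi' > 0],
   [x2 + x3 = 0], whence [x2 = x3 = 0]. *)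
Lemma nonhyperbolic_setE (a1 a2 b1 b2 : R) (phi : R -> R) : sigmoid phi ->
  nonhyperbolic_set a1 a2 b1 b2 phi = [set u *: e_u | u in `]-1, 1[].
Proof.
move=> [sphi _ _ phi'_gt0].
have dphi u : derivable phi u 1 by exact: (sphi 0%N u I).
have d1 x2 x3 u : (fun u : R => f1 a1 a2 b1 b2 x2 x3 (phi u))^`() u =
    - (x2 + x3) / 2 * (phi^`())%classic u.
  have -> : (fun u : R => f1 a1 a2 b1 b2 x2 x3 (phi u)) =
      (fun u => (x3 - x2) / 2 + phi u * (- (x2 + x3) / 2)).
    by apply/funext => t; rewrite f1E; field.
  rewrite !derive1E deriveD//; last exact: derivableM.
  by rewrite derive_cst add0r deriveMr// mulrC.
apply/seteqP; split=> [p [[f0 u1]]|_ [u u1 <-]] /=.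
- rewrite d1 => /eqP; rewrite mulf_eq0 (gt_eqF (phi'_gt0 _ u1)) orbF => /eqP s0.
  rewrite f1E in f0.
  (* In [- f1 - (1 - phi) * (- (x2 + x3) / 2)] both [phi] and [x3] cancel, leaving [x2]. *)
  have x2E : p 0 1 = 0.
    have -> : p 0 1 = - (- ((1 + phi (p 0 0)) / 2) * p 0 1
      + (1 - phi (p 0 0)) / 2 * p 0 2)
      - (1 - phi (p 0 0)) * (- (p 0 1 + p 0 2) / 2) by field.
    by rewrite f0 s0 mulr0 subr0 oppr0.
  have x3E : p 0 2 = 0 by lra.
  exists (p 0 0); first by rewrite /= in_itv/= -ltr_norml.
  by rewrite scale_e_u [RHS]vec3_eta x2E x3E.
- rewrite scale_e_u /nonhyperbolic_set /sliding_manifold /=.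
  have [-> -> ->] : [/\ vec3 u 0 0 0 0 = u, vec3 u 0 0 0 1 = 0 &
    vec3 u 0 0 0 2 = 0] by rewrite !mxE.
  split; last by rewrite d1 addr0 oppr0 !mul0r.
  split; first by rewrite f1E !mulr0 addr0.
  by move: u1; rewrite /= in_itv/= ltr_norml.
Qed.

(** The summand [0] gives the map the shape [x + s *: v] of the lemmas on affine maps. *)
Lemma regular_parametrization_e_u :
  regular_parametrization `]-1, 1[ (fun t : R => 0 + t *: e_u)
    [set u *: e_u | u in `]-1, 1[].
Proof.
split.
- exact: smooth_on_line.
- move=> t _; rewrite derive1_line; apply/eqP => /rowP/(_ 0).
  by rewrite !mxE /=; apply/eqP; rewrite oner_eq0.
- by apply/eq_imagel => t _; rewrite add0r.
(* The coordinate [u] is a continuous left inverse. *)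
- exists (fun p : 'rV[R]_3 => p 0 0); split.
    by apply: continuous_subspaceT => p; exact: coord_continuous.
  by move=> t _; rewrite add0r scale_e_u mxE.
Qed.

Lemma smooth_curve_e_u :
  smooth_curve [set u *: (e_u : 'rV[R]_3) | u in `]-1, 1[].
Proof.
have [_ _ im _] := regular_parametrization_e_u.
split.
- by exists 0, 0; rewrite ?scale0r//= in_itv/= oppr_lt0 ltr01.
- rewrite -im; apply: connected_continuous_connected.
    by apply/connected_intervalP; exact: interval_is_interval.
  by apply: continuous_subspaceT; exact: continuous_line.
(* One global chart serves every point. *)
- move=> p _; exists setT, `]-1, 1[%classic, (fun t : R => 0 + t *: e_u).
  split => //.
  + exact: openT.
  + exact: interval_is_interval.
  + by rewrite setIT; exact: regular_parametrization_e_u.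
Qed.

(** A path in the segment has zero second and third coordinates, hence so has its velocity;
    conversely, each multiple of [e_u] is the velocity of a uniform motion lasting a short enough
    time. *)
Lemma tangent_space_e_u (p : 'rV[R]_3) :
  [set u *: e_u | u in `]-1, 1[] p ->
  tangent_space [set u *: e_u | u in `]-1, 1[] p =
    [set k *: e_u | k in [set: R]].
Proof.
move=> [u /= ]; rewrite in_itv/= => /andP[u1 u2] <-{p}.
apply/seteqP; split=> [_ [d [g [d0 sg gC _ <-]]]|_ [k _ <-]] /=.
- have dg : derivable g 0 1 by apply: (sg 0%N); rewrite /= in_itv/= oppr_lt0 d0.
  have coord0 j : j != 0 -> (g^`() 0 : 'rV_3) 0 j = 0.
    move=> j0; rewrite derive1E (derive_mx dg) mxE.
    (* The path is controlled only on []-d, d[], so its coordinate is compared with the zero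
       function near [0]. *)
    rewrite -[RHS](@derive_cst R R R 0 0 1); apply: near_eq_derive.
    near=> t.
    have /gC[s _ <-] : `]- d, d[%classic t.
      by near: t; apply: near_in_itvoo; rewrite in_itv/= oppr_lt0 d0.
    by rewrite !mxE; case: j j0 => -[|[|[|//]]] lj //= _; rewrite mulr0.
  exists ((g^`() 0 : 'rV_3) 0 0) => //.
  by rewrite scale_e_u [RHS]vec3_eta (coord0 1)// (coord0 2).
(* For [|t| < d], [|t * k| <= |t| * (1 + |k|) < 1 - |u|] keeps [u + t * k] in the interval; the
   [1 +] keeps the denominator positive when [k = 0]. *)
- pose d := (1 - `|u|) / (1 + `|k|).
  have k0 : 0 < 1 + `|k| by rewrite ltr_pwDl.
  have nu : `|u| < 1 by rewrite ltr_norml u1 u2.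
  exists d, (fun t => u *: e_u + t *: (k *: e_u)); split.
  + by rewrite divr_gt0// subr_gt0.
  + exact: smooth_on_line.
  + move=> t; rewrite /= in_itv/= -ltr_norml => td.
    exists (u + t * k); last by rewrite scalerDl scalerA.
    rewrite /= in_itv/= -ltr_norml (le_lt_trans (ler_normD _ _))//.
    rewrite -ltrBrDl normrM; move: td; rewrite ltr_pdivlMr//; apply: le_lt_trans.
    by rewrite ler_wpM2l// lerDr.
  + by rewrite scale0r addr0.
  + by rewrite derive1_line.
Unshelve. all: by end_near.
Qed.

End AxisOfFastVariable.

Theorem proposition1 (R : realType) (a1 a2 b1 b2 eps : R) (phi : R -> R)
    (ha1 : a1 = 1 \/ a1 = -1) (ha2 : a2 = 1 \/ a2 = -1)
    (heps : 0 < eps) (hphi : sigmoid phi) :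
  let L := nonhyperbolic_set a1 a2 b1 b2 phi in
  smooth_curve L /\
  forall p : 'rV[R]_3, L p -> tangent_space L p = [set k *: e_u | k in [set: R]].
Proof.
rewrite /= (nonhyperbolic_setE _ _ _ _ hphi).
split; first exact: smooth_curve_e_u.
exact: tangent_space_e_u.
Qed.
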